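(* Let $\mathcal{I}$ be the set of even positive integers. There is an infinite sequence $\{C_n\}_{n\in\mathcal{I}}$, where $C_n$ is a real symmetric positive-semidefinite matrix of order $n$, such that $$\operatorname{linx}\left(C_n,\tfrac{n}{2}\right)-\operatorname{linx}\left(C_n,\tfrac{n}{2};I_n\right)\ \ge\ \tfrac14\log\left(\tfrac43\right)n\qquad\text{for all } n\in\mathcal{I}.$$ Moreover, for $n=2$ this is the maximum possible lower bound on the gap that can be obtained from the lower bound $$\operatorname{linx}(C,1)\ge \tfrac12\log\prod_{i=1}^{2}\left(\tfrac12\lambda_i(C)^2+\tfrac12\right),$$ where $\lambda_1(C),\lambda_2(C)$ are the eigenvalues of $C$. That is, $$\max_{C}\left\{\tfrac12\log\prod_{i=1}^{2}\left(\tfrac12\lambda_i(C)^2+\tfrac12\right)-\operatorname{linx}(C,1;I_2)\right\}=\tfrac12\log\left(\tfrac43\right),$$ where the maximum is over all real symmetric positive-semidefinite matrices $C$ of order $2$.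
   Context: Notation: $\mathbf{e}$ is the all-ones vector in $\mathbb{R}^n$; $\operatorname{Diag}(x)$ is the diagonal matrix with diagonal $x$; $\circ$ is the Hadamard (entrywise) product; $I_n$ is the identity matrix of order $n$; $\operatorname{ldet}$ is the natural logarithm of the determinant (with value $-\infty$ if the determinant is $0$). For integers $0<s<n$, $P(n,s):=\{x\in\mathbb{R}^n:\mathbf{e}^\top x=s,\ 0\le x\le\mathbf{e}\}$. For a real symmetric positive-semidefinite matrix $C$ of order $n$, the linx bound is $$\operatorname{linx}(C,s):=\max\left\{\tfrac12\operatorname{ldet}\big(C\operatorname{Diag}(x)C+\operatorname{Diag}(\mathbf{e}-x)\big): x\in P(n,s)\right\}.$$ A mask of order $n$ is a real symmetric positive-semidefinite matrix $M$ of order $n$ with all diagonal entries equal to $1$. The masked linx bound is $\operatorname{linx}(C,s;M):=\operatorname{linx}(C\circ M,s)$. *)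

(* Defs.v *)
From HB Require Import structures.
From mathcomp Require Import all_boot all_order all_algebra.
From mathcomp Require Import all_classical all_reals all_analysis.
Import Order.TTheory GRing.Theory Num.Theory.
Import numFieldNormedType.Exports.

Set Implicit Arguments.
Unset Strict Implicit.
Unset Printing Implicit Defensive.

Local Open Scope classical_set_scope.
Local Open Scope ring_scope.

Section Linx.
Context {R : realType}.

Definition psd (n : nat) (C : 'M[R]_n) : Prop :=
  C^T = C /\ forall v : 'rV[R]_n, 0 <= (v *m C *m v^T) 0 0.

Definition hadamard (m n : nat) (A B : 'M[R]_(m, n)) : 'M[R]_(m, n) :=
  map2_mx *%R A B.

Definition mask (n : nat) (M : 'M[R]_n) : Prop :=
  psd M /\ forall i, M i i = 1.

(* [lne] is the extended natural logarithm, equal to -oo on (-oo, 0]. *)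
Definition ldet (n : nat) (A : 'M[R]_n) : \bar R := lne (\det A)%:E.

Definition Pns (n s : nat) : set 'rV[R]_n :=
  [set x | \sum_i x 0 i = s%:R /\ forall i, 0 <= x 0 i <= 1].
Arguments Pns n s : clear implicits.

Definition linx_mx (n : nat) (C : 'M[R]_n) (x : 'rV[R]_n) : 'M[R]_n :=
  C *m diag_mx x *m C + diag_mx (const_mx 1 - x).

Definition linx_obj (n : nat) (C : 'M[R]_n) (x : 'rV[R]_n) : \bar R :=
  ((1 / 2)%:E * ldet (linx_mx C x))%E.

(* The supremum is attained as soon as s <= n: see [linx_attained]. For psd C
   and 0 < s < n it is finite, as linx_mx C is positive definite at the point
   (s / n, ..., s / n); hence differences of linx bounds in \bar R are then
   differences of real numbers. *)
Definition linx (n : nat) (C : 'M[R]_n) (s : nat) : \bar R :=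
  ereal_sup [set linx_obj C x | x in Pns n s].

Definition linx_masked (n : nat) (C : 'M[R]_n) (s : nat) (M : 'M[R]_n) :
    \bar R :=
  linx (hadamard C M) s.

(* l lists the eigenvalues of A with their algebraic multiplicities. *)
Definition eigenvalues (n : nat) (A : 'M[R]_n) (l : 'I_n -> R) : Prop :=
  char_poly A = \prod_(i < n) ('X - (l i)%:P).

Definition eig_bound (n : nat) (l : 'I_n -> R) : R :=
  1 / 2 * ln (\prod_(i < n) (1 / 2 * l i ^+ 2 + 1 / 2)).

Definition is_max (A : set (\bar R)) (m : \bar R) : Prop := A m /\ ubound A m.

Lemma mask1 (n : nat) : mask (1%:M : 'M[R]_n).
Proof.
split=> [|i]; last by rewrite mxE eqxx.
split=> [|v]; first exact: trmx1.
by rewrite mulmx1 mxE sumr_ge0// => i _; rewrite mxE -expr2 sqr_ge0.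
Qed.

Lemma Pns_neq0 (n s : nat) : (s <= n)%N -> Pns n s !=set0.
Proof.
move=> sn; exists (\row_(i < n) (i < s)%N%:R); split=> [|i]; last first.
  by rewrite mxE; case: (_ < _)%N; rewrite ?lexx ?ler01.
rewrite (eq_bigr (fun i : 'I_n => (i < s)%N%:R)); last by move=> i _; rewrite mxE.
rewrite -natr_sum; congr (_%:R).
rewrite -(big_mkord xpredT (fun i => (i < s)%N : nat)) (big_cat_nat (leq0n s) sn)/=.
rewrite (eq_big_nat _ _ (F2 := fun=> 1%N)); last by move=> i /andP[_ ->].
rewrite [X in (_ + X)%N](eq_big_nat _ _ (F2 := fun=> 0%N)); last first.
  by move=> i /andP[si _]; rewrite ltnNge si.
by rewrite !sum_nat_const_nat muln1 muln0 subn0 addn0.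
Qed.

Lemma compact_Pns (n s : nat) : compact (Pns n s).
Proof.
have -> : Pns n s = [set x : 'rV[R]_n | forall i, `[0, 1]%classic (x ord0 i)]
    `&` [set x : 'rV[R]_n | \sum_i x 0 i = s%:R].
  apply/seteqP; split=> x /=.
    by move=> [xs x01]; split=> // i; rewrite in_itv/=; exact: x01.
  by move=> [x01 xs]; split=> // i; have := x01 i; rewrite in_itv.
apply: compact_closedI.
  by apply: (@rV_compact R n (fun=> `[0, 1]%classic)) => i; exact: segment_compact.
apply: (@preimage_closed _ _ (fun x : 'rV[R]_n => \sum_i x 0 i) [set s%:R]) => //.
  move=> x _; apply: (continuous_big add_continuous) => i _.
  exact: coord_continuous.
Qed.

Lemma continuous_det_linx_mx (n : nat) (C : 'M[R]_n) :
  continuous (fun x : 'rV[R]_n => \det (linx_mx C x)).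
Proof.
pose T : topologicalType := 'rV[R]_n.
have cst (a : R) : continuous (fun _ : T => a)
  by exact: (@cst_continuous T R a).
have cD (f g : T -> R) : continuous f -> continuous g ->
    continuous (fun x => f x + g x).
  by move=> cf cg x; exact: (cvgD (cf x) (cg x)).
have cM (f g : T -> R) : continuous f -> continuous g ->
    continuous (fun x => f x * g x).
  by move=> cf cg x; exact: (cvgM (cf x) (cg x)).
have cS (I : finType) (F : I -> T -> R) : (forall i, continuous (F i)) ->
    continuous (fun x => \sum_i F i x).
  by move=> cF; apply: continuous_big => // -[a b]; exact: add_continuous.
have cP (I : finType) (F : I -> T -> R) : (forall i, continuous (F i)) ->
    continuous (fun x => \prod_i F i x).
  by move=> cF; apply: continuous_big => // -[a b]; exact: mul_continuous.
have cx k : continuous (fun x : T => x 0 k) by exact: coord_continuous.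
have cE i j : continuous (fun x : T => linx_mx C x i j).
  have -> : (fun x : T => linx_mx C x i j) = (fun x : T =>
      \sum_k C i k * x 0 k * C k j + (i == j)%:R * (1 + -1 * x 0 i)).
    apply/funext => x; rewrite !mxE mul_mx_diag mulr_natl mulN1r.
    by congr (_ + _); apply: eq_bigr => k _; rewrite !mxE.
  apply: (cD); first by apply: cS => k; apply: (cM) => //; apply: (cM).
  by apply: (cM) => //; apply: (cD) => //; apply: (cM).
by apply: cS => u; apply: (cM) => //; apply: cP => i; exact: cE.
Qed.

Lemma linx_attained (n s : nat) (C : 'M[R]_n) : (s <= n)%N ->
  exists2 x, Pns n s x & linx C s = linx_obj C x.
Proof.
move=> /Pns_neq0 P0.
have [x Px xmax] := compact_EVT_max P0 (@compact_Pns n s)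
  (continuous_subspaceT (@continuous_det_linx_mx n C)).
exists x; first by rewrite inE in Px.
apply/eqP; rewrite eq_le; apply/andP; split; last first.
  by apply: ereal_sup_ubound; exists x => //; rewrite inE in Px.
apply: ge_ereal_sup => _ [y Py <-].
apply: lee_wpmul2l; first by rewrite lee_fin divr_ge0.
have := xmax y; rewrite inE => /(_ Py).
rewrite /ldet /lne.
set a := \det _; set b := \det _ => ab.
case: (leP a 0) => a0; first by rewrite leNye.
by rewrite (lt_geF (lt_le_trans a0 ab)) lee_fin ler_ln// posrE// (lt_le_trans a0).
Qed.

End Linx.

(* Main.v *)
Require Import Defs.
From mathcomp Require Import all_boot all_order all_algebra.
From mathcomp Require Import all_classical all_reals all_analysis.
From mathcomp Require Import ring lra.
Import Order.TTheory GRing.Theory Num.Theory.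
Local Open Scope classical_set_scope.
Local Open Scope ring_scope.

(** Both bounds are compared at the barycentre x = (1/2, ..., 1/2) of P(n, n/2).
    There the linx matrix is (C^2 + I) / 2, so that the value of the objective
    depends on C only through its eigenvalues. Masking by I replaces C by its
    diagonal, and the determinant becomes a product of affine functions of the
    coordinates of x.

    For the sequence, take C = sqrt 2 P with P an orthogonal projection of rank
    n/2 having constant diagonal 1/2. Since C^2 = 2 P, the determinant of
    (C^2 + I) / 2 = P + I / 2 is (3/2)^(n/2) (1/2)^(n/2) = (3/4)^(n/2)
    ([det_linx_mx_pairing_half]). The diagonal of C is sqrt (1/2), and the masked
    determinant is the product of the 1 - x_i / 2, which under the constraint
    that the x_i sum to n/2 is at most (3/4)^n by the arithmetic-geometric
    inequality, with equality at the barycentre ([linx_masked_pairing_mx]).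
    The quotient of the two values is (4/3)^(n/2).

    For n = 2 the same matrix attains the announced maximum. Conversely, for
    a psd C with diagonal entries a, d and off-diagonal entry b, evaluating the
    masked bound at the barycentre shows that the gap is at most half the
    logarithm of det (C^2 + I) / ((a^2 + 1) (d^2 + 1)). This quotient is at most
    4/3 by an elementary inequality in a, b, d ([det_sqrD1_le]). *)

(** * The linx bound and determinants *)

(** Requiring d > 0 keeps the value of the objective away from -oo, so that it is
    the logarithm of a real number. *)
Lemma le_linx (R : realType) (n s : nat) (C : 'M[R]_n) (x : 'rV[R]_n) (d : R) :
  Pns s x -> \det (linx_mx C x) = d -> 0 < d ->
  ((1 / 2 * ln d)%:E <= linx C s)%E.
Proof.
move=> Px dE d0; apply: ereal_sup_ubound; exists x => //.
by rewrite /linx_obj /ldet /lne dE leNgt d0.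
Qed.

Lemma linx_le (R : realType) (n s : nat) (C : 'M[R]_n) (d : R) : 0 < d ->
  (forall x, Pns s x -> \det (linx_mx C x) <= d) ->
  (linx C s <= (1 / 2 * ln d)%:E)%E.
Proof.
move=> d0 Cd; apply: ge_ereal_sup => _ [x Px <-].
rewrite /linx_obj [(1 / 2 * _)%:E]EFinM.
apply: lee_wpmul2l; first by rewrite lee_fin divr_ge0.
rewrite /ldet /lne; case: (leP (\det _) 0) => [_|x0]; first by rewrite leNye.
by rewrite lee_fin ler_ln ?posrE// Cd.
Qed.

(** The matrix masked by the identity is diagonal, and so is its linx matrix. *)
Lemma det_linx_mx_hadamard1 (R : realType) (n : nat) (C : 'M[R]_n)
    (x : 'rV[R]_n) :
  \det (linx_mx (hadamard C 1%:M) x)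
  = \prod_i (C i i ^+ 2 * x 0 i + (1 - x 0 i)).
Proof.
have -> : linx_mx (hadamard C 1%:M) x =
    diag_mx (\row_i (C i i ^+ 2 * x 0 i + (1 - x 0 i))).
  have -> : hadamard C 1%:M = diag_mx (\row_i C i i).
    by apply/matrixP => i j; rewrite !mxE -mulr_natr; case: eqVneq => [->|];
      rewrite ?mulr1 ?mulr0.
  rewrite /linx_mx !mulmx_diag -raddfD/=; congr diag_mx.
  by apply/rowP => i; rewrite !mxE; ring.
by rewrite det_diag; apply: eq_bigr => i _; rewrite mxE.
Qed.

Lemma linx_mx_half (R : realType) (n : nat) (C : 'M[R]_n) :
  linx_mx C (const_mx (1 / 2)) = (1 / 2) *: (C *m C + 1%:M).
Proof.
rewrite /linx_mx (_ : const_mx 1 - _ = const_mx (1 / 2)); last first.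
  by apply/rowP => i; rewrite !mxE; field.
rewrite diag_const_mx mul_mx_scalar -scalemxAl -[_%:M in LHS]scalemx1.
by rewrite -scalerDr.
Qed.

Lemma Pns_half (R : realType) (n s : nat) : n = (s + s)%N ->
  Pns s (const_mx (1 / 2) : 'rV[R]_n).
Proof.
move=> ->; split=> [|i]; last by rewrite mxE; lra.
rewrite (eq_bigr (fun=> 1 / 2)) => [|i _]; last by rewrite mxE.
by rewrite sumr_const card_ord -[LHS]mulr_natr natrD; field.
Qed.

(** * A scaled projection with constant diagonal *)

(** This is sqrt 2 times the orthogonal projection onto the vectors whose
    coordinates i and i + n/2 agree for all i < n/2. The congruence makes sense
    for every n, so no cast is needed to view it as a family indexed by n; for
    even n it is the block matrix of [pairing_mxE]. *)
Definition pairing_mx (R : realType) (n : nat) : 'M[R]_n :=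
  \matrix_(i, j) ((i == j %[mod n./2])%:R / Num.sqrt 2).

Lemma pairing_mxE (R : realType) (m : nat) :
  pairing_mx R (m + m) = (Num.sqrt 2)^-1 *: block_mx 1%:M 1%:M 1%:M 1%:M.
Proof.
have halfm : (m + m)./2 = m by rewrite addnn doubleK.
have modm (k l : 'I_m) : (k == l %[mod m]) = (k == l) by rewrite !modn_small.
apply/matrixP => i j; rewrite mxE [RHS]mxE mulrC halfm; congr (_ * _).
case: (split_ordP i) => k ->; case: (split_ordP j) => l ->;
  by rewrite ?block_mxEul ?block_mxEur ?block_mxEdl ?block_mxEdr/=
    ?modnDl modm mxE.
Qed.

Lemma pairing_mx_sqr (R : realType) (m : nat) :
  pairing_mx R (m + m) *m pairing_mx R (m + m) =
  block_mx 1%:M 1%:M 1%:M 1%:M.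
Proof.
rewrite pairing_mxE -scalemxAl -scalemxAr scalerA mulmx_block !mulmx1.
rewrite -invfM -expr2 sqr_sqrtr// scale_block_mx.
have -> // : 2^-1 *: (1%:M + 1%:M) = 1%:M :> 'M[R]_m.
by rewrite -raddfD/= scale_scalar_mx -[1 + 1]/(2 : R) mulVf ?pnatr_eq0.
Qed.

(** A multiple sqrt 2 P of a projection satisfies C = (1 / sqrt 2) C C^T, and the
    quadratic form of C C^T at v is the squared norm of v C. *)
Lemma psd_pairing_mx (R : realType) (m : nat) : psd (pairing_mx R (m + m)).
Proof.
set C := pairing_mx R (m + m).
have CT : C^T = C by apply/matrixP => i j; rewrite !mxE eq_sym.
split=> // v.
have -> : C = (Num.sqrt 2)^-1 *: (C *m C^T).
  by rewrite CT pairing_mx_sqr -pairing_mxE.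
rewrite -scalemxAr -scalemxAl mxE mulr_ge0 ?invr_ge0 ?sqrtr_ge0//.
rewrite mulmxA -(mulmxA (v *m C)) -trmx_mul mxE sumr_ge0// => i _.
by rewrite [X in _ * X]mxE -expr2 sqr_ge0.
Qed.

Lemma det_linx_mx_pairing_half (R : realType) (m : nat) :
  \det (linx_mx (pairing_mx R (m + m)) (const_mx (1 / 2))) = (3 / 4) ^+ m.
Proof.
rewrite linx_mx_half pairing_mx_sqr.
(* Eliminate the lower left block: its Schur complement is 1 - 1/4 = 3/4. *)
have -> : (1 / 2) *: (block_mx 1%:M 1%:M 1%:M 1%:M + 1%:M) =
    block_mx 1%:M 0 (1 / 2)%:M 1%:M *m block_mx 1%:M (1 / 2)%:M 0 (3 / 4)%:M
    :> 'M[R]_(m + m).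
  rewrite [X in _ + X]scalar_mx_block add_block_mx scale_block_mx.
  rewrite mulmx_block !mul0mx !mulmx0 !mul1mx !mulmx1 !addr0.
  rewrite -scalar_mxM -!raddfD/= !scale_scalar_mx mulr1.
  by congr block_mx; congr _%:M; field.
by rewrite det_mulmx det_lblock det_ublock !det1 !mul1r det_scalar.
Qed.

(** The factors 1 - x_i / 2 have a prescribed sum, so their product is largest
    when they are all equal. *)
Lemma linx_masked_pairing_mx (R : realType) (m : nat) :
  linx_masked (pairing_mx R (m + m)) m 1%:M =
  (1 / 2 * ln ((3 / 4) ^+ (m + m)))%:E.
Proof.
set C := pairing_mx R (m + m).
have detE x : \det (linx_mx (hadamard C 1%:M) x) = \prod_i (1 - x 0 i / 2).
  rewrite det_linx_mx_hadamard1; apply: eq_bigr => i _.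
  by rewrite mxE eqxx exprMn exprVn sqr_sqrtr// expr1n; field.
have d0 : 0 < (3 / 4 : R) ^+ (m + m) by rewrite exprn_gt0// divr_gt0.
apply/eqP; rewrite eq_le; apply/andP; split.
  apply: linx_le => // x [xm x01]; rewrite detE.
  have e0 (i : 'I_(m + m)) : i \in predT -> 0 <= 1 - x 0 i / 2.
    by move=> _; have := x01 i; lra.
  apply: le_trans (leif_AGM e0).1 _; rewrite cardT size_enum_ord.
  have [m0 | m0] := posnP m.
    (* Here the mean of the factors is 0 / 0 and only its power 0 matters. *)
    have pow0 (y : R) : y ^+ (m + m) = 1 by rewrite m0.
    by rewrite !pow0.
  rewrite big_split/= sumr_const card_ord sumrN -mulr_suml xm.
  suff -> : ((1 *+ (m + m) - m%:R / 2) / (m + m)%:R = 3 / 4 :> R) by [].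
  by rewrite natrD; field; rewrite -natrD pnatr_eq0 addn_eq0 andbb -lt0n.
apply: (@le_linx _ _ _ _ (const_mx (1 / 2))) => //; first exact: Pns_half.
rewrite detE (eq_bigr (fun=> 3 / 4)) => [|i _].
  by rewrite prodr_const card_ord.
by rewrite mxE; field.
Qed.

(** * Matrices of order 2 *)

Lemma big_ord2 (T : Type) (idx : T) (op : Monoid.law idx) (F : 'I_2 -> T) :
  \big[op/idx]_i F i = op (F 0) (F 1).
Proof.
rewrite big_ord_recl big_ord1.
by congr (op (F _) (F _)); apply/val_inj.
Qed.

Lemma det_mx2 (A : comNzRingType) (M : 'M[A]_2) :
  \det M = M 0 0 * M 1 1 - M 0 1 * M 1 0.
Proof.
rewrite (expand_det_row _ 0) big_ord2 /cofactor !det_mx11 !mxE.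
have -> : lift (0 : 'I_2) 0 = 1 by apply/val_inj.
have -> : lift (1 : 'I_2) 0 = 0 by apply/val_inj.
by rewrite /= expr0 expr1; ring.
Qed.

Lemma char_poly_mx2 (A : comNzRingType) (M : 'M[A]_2) :
  char_poly M =
  ('X - (M 0 0)%:P) * ('X - (M 1 1)%:P) - (M 0 1 * M 1 0)%:P.
Proof.
rewrite /char_poly det_mx2 !mxE/= !mulr1n !mulr0n !sub0r mulrNN.
by rewrite polyCM.
Qed.

Lemma eigenvalues_sum_prod2 (R : realType) (C : 'M[R]_2) (l : 'I_2 -> R) :
  eigenvalues C l ->
  l 0 + l 1 = C 0 0 + C 1 1 /\ l 0 * l 1 = C 0 0 * C 1 1 - C 0 1 * C 1 0.
Proof.
rewrite /eigenvalues char_poly_mx2 big_ord2 /= => e.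
(* The values at 0 and 1 determine a monic polynomial of degree 2. *)
have := congr1 (horner^~ 0) e; have := congr1 (horner^~ 1) e.
by rewrite /= !hornerE => e1 e0; split; lra.
Qed.

Lemma det_linx_mx_half2 (R : realType) (C : 'M[R]_2) :
  \det (linx_mx C (const_mx (1 / 2))) =
  (1 + (C 0 0 + C 1 1) ^+ 2 - 2 * (C 0 0 * C 1 1 - C 0 1 * C 1 0)
   + (C 0 0 * C 1 1 - C 0 1 * C 1 0) ^+ 2) / 4.
Proof. by rewrite linx_mx_half det_mx2 !mxE !big_ord2 /=; field. Qed.

(** The eigenvalue bound is the value of the objective at the barycentre. *)
Lemma det_linx_mx_half_eigenvalues2 (R : realType) (C : 'M[R]_2)
    (l : 'I_2 -> R) :
  eigenvalues C l ->
  \det (linx_mx C (const_mx (1 / 2))) = \prod_i (1 / 2 * l i ^+ 2 + 1 / 2).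
Proof.
move=> /eigenvalues_sum_prod2[trE detE].
by rewrite det_linx_mx_half2 -trE -detE big_ord2 /=; field.
Qed.

Lemma psd_mx2 (R : realType) (C : 'M[R]_2) : psd C ->
  [/\ C 1 0 = C 0 1, 0 <= C 0 0, 0 <= C 1 1 & C 0 1 ^+ 2 <= C 0 0 * C 1 1].
Proof.
move=> [CT C0].
have C10 : C 1 0 = C 0 1 by rewrite -[in LHS]CT mxE.
have q x y : 0 <= C 0 0 * x ^+ 2 + 2 * C 0 1 * (x * y) + C 1 1 * y ^+ 2.
  have := C0 (\row_j (if j == 0 then x else y)).
  by rewrite !mxE !big_ord2 !mxE !big_ord2 !mxE/= C10 => q_ge0; lra.
have a0 : 0 <= C 0 0 by have := q 1 0; lra.
have d0 : 0 <= C 1 1 by have := q 0 1; lra.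
split=> //.
(* The form takes the values a det C at (- b, a) and d det C at (d, - b). *)
have a_det : 0 <= C 0 0 * (C 0 0 * C 1 1 - C 0 1 ^+ 2).
  by have := q (- C 0 1) (C 0 0); congr (0 <= _); ring.
have d_det : 0 <= C 1 1 * (C 0 0 * C 1 1 - C 0 1 ^+ 2).
  by have := q (C 1 1) (- C 0 1); congr (0 <= _); ring.
rewrite -subr_ge0.
have [a_gt0 | a_le0] := ltP 0 (C 0 0); first by rewrite -(pmulr_rge0 _ a_gt0).
have [d_gt0 | d_le0] := ltP 0 (C 1 1); first by rewrite -(pmulr_rge0 _ d_gt0).
have a_eq0 : C 0 0 = 0 by lra.
have d_eq0 : C 1 1 = 0 by lra.
have b_eq0 : C 0 1 = 0.
  by have := q 1 1; have := q 1 (- 1); rewrite a_eq0 d_eq0; lra.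
by rewrite a_eq0 b_eq0 expr0n mul0r subrr.
Qed.

(** The left-hand side is det (C^2 + I) for the symmetric matrix C with entries
    a, b, d. With p = a d and t = b^2 it equals
    (a^2 + 1) (d^2 + 1) + t (t + 2 - 2 p), and (a^2 + 1) (d^2 + 1) is
    (p + 1)^2 + (a - d)^2. The excess t (t + 2 - 2 p) is convex in t, hence at
    most the larger of its values 0 and p (2 - p) at the ends of [0, p]; and
    (p + 1)^2 - 3 p (2 - p) = (2 p - 1)^2. *)
Lemma det_sqrD1_le (R : realFieldType) (a b d : R) :
  0 <= a -> 0 <= d -> b ^+ 2 <= a * d ->
  1 + (a + d) ^+ 2 - 2 * (a * d - b ^+ 2) + (a * d - b ^+ 2) ^+ 2 <=
  4 / 3 * ((a ^+ 2 + 1) * (d ^+ 2 + 1)).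
Proof.
move=> a0 d0 tp; set t := b ^+ 2 in tp *.
have t0 : 0 <= t by exact: sqr_ge0.
set p := a * d in tp *.
have chord : 3 * (t * (t + 2 - 2 * p)) <= (p + 1) ^+ 2.
  have [p2 | p2] := leP p 2.
    have below : t * (t - p) <= 0 by rewrite mulr_ge0_le0// subr_le0.
    have edge : t * (2 - p) <= p * (2 - p) by rewrite ler_wpM2r// subr_ge0.
    have := sqr_ge0 (2 * p - 1); lra.
  have : t * (t + 2 - 2 * p) <= 0 by rewrite mulr_ge0_le0//; lra.
  have := sqr_ge0 (p + 1); lra.
have := sqr_ge0 (a - d).
have -> : (a - d) ^+ 2 = (a ^+ 2 + 1) * (d ^+ 2 + 1) - (p + 1) ^+ 2.
  by rewrite /p; ring.
have -> : 1 + (a + d) ^+ 2 - 2 * (p - t) + (p - t) ^+ 2 =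
    (a ^+ 2 + 1) * (d ^+ 2 + 1) + t * (t + 2 - 2 * p) by rewrite /p; ring.
lra.
Qed.

Theorem theorem2p12 (R : realType) :
  (exists C : forall n : nat, 'M[R]_n,
     forall n : nat, (0 < n)%N -> ~~ odd n ->
       psd (C n) /\
       ((1 / 4 * ln (4 / 3) * n%:R)%:E
          <= linx (C n) n./2 - linx_masked (C n) n./2 1%:M)%E)
  /\ (forall (C : 'M[R]_2) (l : 'I_2 -> R), psd C -> eigenvalues C l ->
        ((eig_bound l)%:E <= linx C 1)%E)
  /\ is_max
       [set g : \bar R | exists (C : 'M[R]_2) (l : 'I_2 -> R),
          [/\ psd C, eigenvalues C l
            & g = ((eig_bound l)%:E - linx_masked C 1 1%:M)%E]]
       (1 / 2 * ln (4 / 3))%:E.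
Proof.
have eig_gt0 (l : 'I_2 -> R) : 0 < \prod_i (1 / 2 * l i ^+ 2 + 1 / 2).
  by apply: prodr_gt0 => i _; have := sqr_ge0 (l i); lra.
have q0 : 0 < 3 / 4 :> R by lra.
have ln43 : ln (4 / 3) = - ln (3 / 4) :> R by rewrite -lnV ?posrE// invf_div.
split; [|split; [|split]].
- exists (pairing_mx R) => n n0 n_even.
  have -> : n = (n./2 + n./2)%N by rewrite addnn even_halfK.
  move: n./2 => m; rewrite [(m + m)./2](_ : _ = m); last by rewrite addnn doubleK.
  split; first exact: psd_pairing_mx.
  have qm0 : 0 < (3 / 4 : R) ^+ m by rewrite exprn_gt0.
  rewrite linx_masked_pairing_mx.
  apply: le_trans (leeB (le_linx _ _ _ _ _ _ (Pns_half _ _ _ erefl)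
    (det_linx_mx_pairing_half _ _) qm0) (lexx _)).
  rewrite -EFinB lee_fin !lnXn// ln43 -[_ *+ m]mulr_natr.
  by rewrite -[_ *+ (m + m)]mulr_natr natrD; lra.
- move=> C l _ Cl.
  exact: (le_linx _ _ _ _ _ _ (Pns_half R 2 1 erefl)
    (det_linx_mx_half_eigenvalues2 _ _ _ Cl) (eig_gt0 l)).
- exists (pairing_mx R 2), (fun i => if i == 0 then Num.sqrt 2 else 0).
  have eigE : eigenvalues (pairing_mx R 2)
      (fun i => if i == 0 then Num.sqrt 2 else 0).
    rewrite /eigenvalues char_poly_mx2 !mxE big_ord2 /=.
    set c := 1 / Num.sqrt 2.
    have -> : Num.sqrt 2 = c + c :> R.
      have s0 : Num.sqrt 2 != 0 :> R by rewrite sqrtr_eq0 -ltNge ltr0n.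
      by apply: (mulIf s0); rewrite -expr2 sqr_sqrtr// /c; field.
    by clearbody c; rewrite polyC0 polyCD polyCM; ring.
  split=> //; first exact: (psd_pairing_mx R 1).
  rewrite (linx_masked_pairing_mx R 1) -EFinB /eig_bound.
  rewrite -(det_linx_mx_half_eigenvalues2 _ _ _ eigE) (det_linx_mx_pairing_half R 1).
  by rewrite !lnXn// ln43; congr _%:E; lra.
- move=> _ [C [l [Cpsd Cl ->]]].
  have [C10 a0 d0 tp] := psd_mx2 _ _ Cpsd.
  have half_det : \det (linx_mx (hadamard C 1%:M) (const_mx (1 / 2))) =
      (C 0 0 ^+ 2 + 1) * (C 1 1 ^+ 2 + 1) / 4.
    by rewrite det_linx_mx_hadamard1 big_ord2 /= !mxE; field.
  have num_gt0 : 0 < (C 0 0 ^+ 2 + 1) * (C 1 1 ^+ 2 + 1).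
    by rewrite mulr_gt0// ltr_wpDl// sqr_ge0.
  have pos : 0 < (C 0 0 ^+ 2 + 1) * (C 1 1 ^+ 2 + 1) / 4 by rewrite divr_gt0.
  apply: le_trans (leeB (lexx _) (le_linx _ _ _ _ _ _ (Pns_half R 2 1 erefl)
    half_det pos)) _.
  rewrite -EFinB lee_fin /eig_bound -mulrBr ler_wpM2l//.
  rewrite -ln_div ?posrE ?eig_gt0// ler_ln ?posrE ?divr_gt0//.
  rewrite ler_pdivrMr// -(det_linx_mx_half_eigenvalues2 _ _ _ Cl).
  rewrite det_linx_mx_half2 C10 -expr2 mulrA ler_pM2r ?invr_gt0//.
  exact: det_sqrD1_le.
Qed.
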